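(* Let $H$ be a closed subgroup of a compact group $G$ and $n\ge1$. Then $d^{(n)}(H,G)\le d^{(n)}(H)$.
   Context: For a compact group $X$, $\mu_X$ denotes its normalized Haar measure and $\mu_X^m$ the product measure on $X^m$. Commutators: $[x,y]=x^{-1}y^{-1}xy$, $[x_1]=x_1$, $[x_1,\dots,x_{k+1}]=[[x_1,\dots,x_k],x_{k+1}]$. For a compact group $X$ and $n\ge1$, $d^{(n)}(X)=\mu_X^{n+1}(\{(x_1,\dots,x_{n+1})\in X^{n+1}: [x_1,\dots,x_{n+1}]=1\})$ (the $n$-th nilpotency degree). For a closed subgroup $H$ of $G$, $d^{(n)}(H,G)=(\mu_H^n\times\mu_G)(\{(h_1,\dots,h_n,g)\in H^n\times G: [h_1,\dots,h_n,g]=1\})$ (the relative $n$-th nilpotency degree). *)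

(* Defs.v *)
From HB Require Import structures.
From mathcomp Require Import all_boot all_order all_algebra.
From mathcomp Require Import all_classical all_reals all_analysis.
Set Implicit Arguments. Unset Strict Implicit. Unset Printing Implicit Defensive.
Import Order.TTheory GRing.Theory Num.Theory.
Local Open Scope classical_set_scope.
Local Open Scope ring_scope.

Definition borel (T : ptopologicalType) := g_sigma_algebraType (@open T).

Definition pw (m : nat) (T : ptopologicalType) := {ptws 'I_m -> T}.
HB.instance Definition _ m T := Topological.on (pw m T).
HB.instance Definition _ m T := Pointed.on (pw m T).

Section CompactGroups.
Variable G : ptopologicalType.
Variables (mul : G -> G -> G) (inv : G -> G) (one : G).

Definition is_compact_group : Prop :=
  [/\ associative mul, left_id one mul & left_inverse one inv mul] /\
  [/\ continuous (fun p : G * G => mul p.1 p.2), continuous inv,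
      hausdorff_space G & compact [set: G]].

Definition closed_subgroup (H : set G) : Prop :=
  [/\ closed H, H one,
      (forall x y, H x -> H y -> H (mul x y)) &
      (forall x, H x -> H (inv x))].

Definition comm (x y : G) : G := mul (inv x) (mul (inv y) (mul x y)).

Fixpoint iter_comm (f : nat -> G) (k : nat) : G :=
  match k with
  | 0 => f 0%N
  | k'.+1 => comm (iter_comm f k') (f k)
  end.

(* [x_1, ..., x_{n+1}] = 1, for x : G^{n+1} (coordinates indexed 0..n) *)
Definition comm_trivial_set (n : nat) : set (pw n.+1 G) :=
  [set x | iter_comm (fun i => x (inord i)) n = one].
End CompactGroups.
Arguments comm_trivial_set [G] mul inv one n _.


Section Measures.
Variable R : realType.
Local Open Scope ereal_scope.

Definition regular_measure (T : ptopologicalType)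
    (mu : set (borel T) -> \bar R) : Prop :=
  forall A : set T, measurable (A : set (borel T)) ->
    mu A = ereal_inf [set mu U | U in [set U : set T | open U /\ A `<=` U]] /\
    mu A = ereal_sup [set mu C | C in [set C : set T | compact C /\ C `<=` A]].

(* mu is the normalized Haar measure of the closed subgroup H of G,
   realized as a Borel measure on G concentrated on H.  For H = [set: G]
   this is the normalized Haar measure of G. *)
Definition haar_measure (G : ptopologicalType) (mul : G -> G -> G) (H : set G)
    (mu : {measure set (borel G) -> \bar R}) : Prop :=
  [/\ mu [set: G] = 1, mu H = 1, regular_measure mu &
      forall h (A : set G), H h -> measurable (A : set (borel G)) ->
        mu [set mul h a | a in A] = mu A].

Definition is_product_measure (G : ptopologicalType) (m : nat)
    (mus : 'I_m -> {measure set (borel G) -> \bar R})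
    (nu : {measure set (borel (pw m G)) -> \bar R}) : Prop :=
  regular_measure nu /\
  forall B : 'I_m -> set G, (forall i, measurable (B i : set (borel G))) ->
    nu [set x : pw m G | forall i, B i (x i)] = \prod_(i < m) mus i (B i).
End Measures.

(* Main.v *)
Require Import Defs.
From HB Require Import structures.
From mathcomp Require Import all_boot all_order all_algebra.
From mathcomp Require Import all_classical all_reals all_analysis.
Import Order.TTheory GRing.Theory Num.Theory.
Local Open Scope classical_set_scope.
Local Open Scope ring_scope.

(* For a closed subgroup C of G one has mu_G(C) <= mu_H(C n H), because distinct
   cosets of C n H in H lie in distinct cosets of C in G.  For C the centralizer of
   [x_1, ..., x_n] this compares the sections over (x_1, ..., x_n) of the two sets
   of the theorem.  Without second countability these sets need not belong to the
   product sigma-algebra, so Fubini is not available.  Instead, given an open U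
   containing the set for H, the tube lemma yields around each point of H^n an open
   box N over which the set for G lies in a cylinder N x V with V open,
   mu_G(V) < mu_H(C n H) + e, while N x (C n H) lies in U.  Finitely many such boxes
   cover H^n, and the product formula gives nu_HG <= nu_H(U) + e; outer regularity of
   nu_H concludes. *)

Set Implicit Arguments.
Unset Strict Implicit.

(** * Borel sets and continuous maps *)

Lemma open_borel (T : ptopologicalType) (A : set T) :
  open A -> measurable (A : set (borel T)).
Proof. by move=> oA; exact: sub_sigma_algebra. Qed.

Lemma closed_borel (T : ptopologicalType) (A : set T) :
  closed A -> measurable (A : set (borel T)).
Proof.
move=> cA; rewrite -(setCK A); apply: measurableC.
by apply: open_borel; exact: closed_openC.
Qed.

Lemma continuous_borel (T U : ptopologicalType) (f : T -> U) (B : set U) :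
  continuous f -> measurable (B : set (borel U)) ->
  measurable (f @^-1` B : set (borel T)).
Proof.
move=> /continuousP cf mB; rewrite -[_ @^-1` _]setTI.
have mf : measurable_fun (setT : set (borel T)) (f : borel T -> borel U).
  apply: (@measurability _ _ (borel T) (borel U) setT f (@open U)) => // _ [V oV <-].
  by rewrite setTI; apply: open_borel; exact: cf.
exact: mf.
Qed.

Lemma ord_maxPn n (i : 'I_n.+1) : ~~ (i < n)%N -> i = ord_max.
Proof.
by move=> ni; apply: val_inj; apply/eqP; rewrite eqn_leq -ltnS ltn_ord /= leqNgt ni.
Qed.

(** * Topology of finite powers: boxes, cylinders and the tube lemma *)

Section PowerTopology.
Context {G : ptopologicalType}.

Lemma pw_coord_continuous m (i : 'I_m) : continuous (fun x : pw m G => x i).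
Proof. exact: (@proj_continuous 'I_m (fun=> G) i). Qed.

(** The topology of [pw m G] is the supremum of the topologies pulled back along the coordinates, so
    convergence is tested coordinatewise. *)
Lemma pw_cvg m (F : set_system (pw m G)) (x : pw m G) : Filter F ->
  (forall i, (fun y : pw m G => y i) @ F --> x i) -> F --> x.
Proof.
move=> FF Fx; apply/(@cvg_sup (pw m G) 'I_m) => i A [_ [[B oB <-] Bx BA]].
apply: filterS BA _; apply: (Fx i B); exact: open_nbhs_nbhs.
Qed.

(** The open boxes around [x] generate a filter that converges to [x] in each coordinate, so every
    neighborhood of [x] contains one of them. *)
Lemma pw_nbhs_box m (x : pw m G) (A : set (pw m G)) : nbhs x A ->
  exists N : 'I_m -> set G, (forall i, open_nbhs (x i) (N i)) /\
    [set y : pw m G | forall i, N i (y i)] `<=` A.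
Proof.
pose F := filter_from [set N : 'I_m -> set G | forall i, open_nbhs (x i) (N i)]
  (fun N => [set y : pw m G | forall i, N i (y i)]).
have FF : Filter F.
  apply: filter_from_filter; first by exists (fun=> setT) => i; split => //; exact: openT.
  move=> N M oN oM; exists (fun i => N i `&` M i).
    by move=> i; apply: open_nbhsI; [exact: oN|exact: oM].
  by move=> y NMy; split => i; case: (NMy i).
have /[apply] : F --> x.
  apply: pw_cvg => i A'; rewrite nbhsE => -[B oB BA].
  exists (fun j => if j == i then B else setT).
    by move=> j; case: eqP => [->//|_]; split => //; exact: openT.
  by move=> y /(_ i) /=; rewrite eqxx; exact: BA.
by case=> N oN NA; exists N; split.
Qed.

(** Plays the role of the pair of a point of G^n and an element of G without leaving G^(n+1); the
    last coordinate of [x] is a dummy. *)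
Definition set_last n (x : pw n.+1 G) (g : G) : pw n.+1 G :=
  fun i => if (i < n)%N then x i else g.

Definition last_coord n (x : pw n.+1 G) : G := x ord_max.

Lemma set_last_id n (x : pw n.+1 G) : set_last x (last_coord x) = x.
Proof.
apply: functional_extensionality_dep => i; rewrite /set_last.
by case: ifPn => // /ord_maxPn->.
Qed.

Lemma set_last_continuous n :
  continuous (fun p : pw n.+1 G * G => set_last p.1 p.2).
Proof.
move=> p; apply: pw_cvg => i.
suff : (fun p : pw n.+1 G * G => set_last p.1 p.2 i) @ p --> set_last p.1 p.2 i by [].
rewrite /set_last; case: ifP => _; last exact: cvg_snd.
apply: (@cvg_comp _ _ _ (fun p : pw n.+1 G * G => p.1)
  (fun y : pw n.+1 G => y i) _ (nbhs p.1)).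
  exact: cvg_fst.
exact: pw_coord_continuous.
Qed.

(** A box in G^n times all of G; the value of [N] at [ord_max] is irrelevant. *)
Definition init_box n (N : 'I_n.+1 -> set G) : set (pw n.+1 G) :=
  [set x | forall i : 'I_n.+1, (i < n)%N -> N i (x i)].

Lemma open_init_box n (N : 'I_n.+1 -> set G) :
  (forall i, open (N i)) -> open (init_box N).
Proof.
move=> oN; rewrite openE => x Nx; rewrite /interior.
apply: (@filter_forall _ 'I_n.+1 (fun i (y : pw n.+1 G) => (i < n)%N -> N i (y i))
  (nbhs x) (nbhs_filter x)) => i.
case: (boolP (i < n)%N) => ni; last first.
  by apply: filterE.
have : nbhs x ((fun y : pw n.+1 G => y i) @^-1` N i).
  apply: pw_coord_continuous; apply: open_nbhs_nbhs; split => //; exact: Nx.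
by apply: filterS => y ? _.
Qed.

Lemma closed_init_box n (N : 'I_n.+1 -> set G) :
  (forall i, closed (N i)) -> closed (init_box N).
Proof.
move=> cN.
rewrite (_ : init_box N = \bigcap_(i in [set i : 'I_n.+1 | (i < n)%N])
                            ((fun x : pw n.+1 G => x i) @^-1` N i)) //.
apply: closed_bigI => i _; apply: preimage_closed => //.
by apply: in1W; exact: pw_coord_continuous.
Qed.

(** Compactness of [K] makes one neighborhood of the first n coordinates of [x] serve for all values
    in [K] of the last coordinate. *)
Lemma tube_lemma n (x : pw n.+1 G) (K : set G) (W : set (pw n.+1 G)) :
  compact K -> open W -> (forall g, K g -> W (set_last x g)) ->
  exists N : 'I_n.+1 -> set G, (forall i, open_nbhs (x i) (N i)) /\
    forall y, init_box N y -> K (last_coord y) -> W y.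
Proof.
move=> /compact_near_coveringP cK oW KW.
have /pw_nbhs_box[N [oN NW]] : \forall y \near x, K `<=` [set g | W (set_last y g)].
  apply: (cK _ (nbhs x) (fun y g => W (set_last y g))) => g /KW Wg.
  have : nbhs (x, g) ((fun p : pw n.+1 G * G => set_last p.1 p.2) @^-1` W).
    by apply: set_last_continuous; exact: open_nbhs_nbhs.
  by case=> -[A B] /= [xA gB] AB; exists (B, A) => // -[b a] [/= Bb Aa]; exact: (AB (a, b)).
exists N; split => // y Ny Ky; rewrite -(set_last_id y).
(* The box [N] also constrains the last coordinate; resetting that coordinate to [x ord_max] meets
   the constraint, and the outer [set_last] overwrites it. *)
suff -> : set_last y (last_coord y) = set_last (set_last y (x ord_max)) (last_coord y).
  apply: NW Ky => i; rewrite /set_last; case: ifPn => [/Ny//|/ord_maxPn->].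
  by case: (oN ord_max).
by apply: functional_extensionality_dep => i; rewrite /set_last; case: ifP.
Qed.

End PowerTopology.

(** * Algebra and continuity in a compact group; cosets and centralizers *)

Section CompactGroupTheory.
Context {G : ptopologicalType} {mul : G -> G -> G} {inv : G -> G} {one : G}.
Hypothesis cG : is_compact_group mul inv one.

Lemma gmulA : associative mul. Proof. by case: cG => -[]. Qed.
Lemma gmul1g : left_id one mul. Proof. by case: cG => -[]. Qed.
Lemma gmulVg : left_inverse one inv mul. Proof. by case: cG => -[]. Qed.

Lemma gmulKg x y : mul (inv x) (mul x y) = y.
Proof. by rewrite gmulA gmulVg gmul1g. Qed.

Lemma gmulgI x : injective (mul x).
Proof. by move=> y z /(congr1 (mul (inv x))); rewrite !gmulKg. Qed.

Lemma gmulg1 : right_id one mul.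
Proof. by move=> x; apply: (@gmulgI (inv x)); rewrite gmulKg gmulVg. Qed.

Lemma gmulgV x : mul x (inv x) = one.
Proof. by apply: (@gmulgI (inv x)); rewrite gmulKg gmulg1. Qed.

Lemma gmulKVg x y : mul x (mul (inv x) y) = y.
Proof. by rewrite gmulA gmulgV gmul1g. Qed.

Lemma gmulgK x y : mul (mul y x) (inv x) = y.
Proof. by rewrite -gmulA gmulgV gmulg1. Qed.

Lemma continuous_mul (T : topologicalType) (f g : T -> G) :
  continuous f -> continuous g -> continuous (fun x => mul (f x) (g x)).
Proof.
move=> cf cg x; have [_ [cm _ _ _]] := cG.
apply: (@continuous_comp _ _ _ (fun x => (f x, g x)) (fun p => mul p.1 p.2)).
  by apply: cvg_pair; [exact: cf|exact: cg].
exact: cm.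
Qed.

Lemma continuous_inv (T : topologicalType) (f : T -> G) :
  continuous f -> continuous (fun x => inv (f x)).
Proof.
move=> cf x; have [_ [_ ci _ _]] := cG.
by apply: (@continuous_comp _ _ _ f inv); [exact: cf|exact: ci].
Qed.

Lemma continuous_comm (T : topologicalType) (f g : T -> G) :
  continuous f -> continuous g -> continuous (fun x => comm mul inv (f x) (g x)).
Proof.
by move=> cf cg; do ?[exact: continuous_inv|exact: cf|exact: cg|apply: continuous_mul].
Qed.

Lemma comm_eq1 x y : comm mul inv x y = one <-> mul x y = mul y x.
Proof.
rewrite /comm; split=> [e|->]; last by rewrite gmulKg gmulVg.
apply: (@gmulgI (inv y)); apply: (@gmulgI (inv x)).
by rewrite e gmulKg gmulVg.
Qed.

Lemma coset_preimage (h : G) (C : set G) :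
  [set mul h c | c in C] = mul (inv h) @^-1` C.
Proof.
apply/seteqP; split=> [_ [c Cc <-]|x /= Cx]; first by rewrite /= gmulKg.
by exists (mul (inv h) x) => //; rewrite gmulKVg.
Qed.

Lemma closed_coset (h : G) (C : set G) : closed C -> closed [set mul h c | c in C].
Proof.
move=> cC; rewrite coset_preimage; apply: preimage_closed => //.
by apply: in1W; apply: continuous_mul => x; [exact: cvg_cst|exact: cvg_id].
Qed.

Lemma closed_set1_group : closed [set one].
Proof.
have [_ [_ _ hG _]] := cG.
by apply: accessible_closed_set1; exact: hausdorff_accessible.
Qed.

Lemma closed_centralizer c : closed_subgroup mul inv one [set g | comm mul inv c g = one].
Proof.
split.
- apply: (@preimage_closed _ _ (comm mul inv c) [set one]); last exact: closed_set1_group.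
  by apply: in1W; apply: continuous_comm => x; [exact: cvg_cst|exact: cvg_id].
- by apply/comm_eq1; rewrite gmul1g gmulg1.
- by move=> x y /comm_eq1 cx /comm_eq1 cy; apply/comm_eq1; rewrite gmulA cx -gmulA cy gmulA.
- move=> x /comm_eq1 cx; apply/comm_eq1; apply: (@gmulgI x).
  by rewrite gmulKVg gmulA -cx gmulgK.
Qed.

(** * Comparison of the Haar measures of G and H on a closed subgroup *)

Section HaarMeasure.
Context {R : realType} {H C : set G} {muG muH : {measure set (borel G) -> \bar R}}.
Hypotheses (sH : closed_subgroup mul inv one H) (sC : closed_subgroup mul inv one C).
Hypotheses (hG : haar_measure mul [set: G] muG) (hH : haar_measure mul H muH).
Local Open Scope ereal_scope.

Lemma haar_fin (X : set G) (mu : {measure set (borel G) -> \bar R}) :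
  haar_measure mul X mu ->
  forall A : set G, measurable (A : set (borel G)) -> mu A \is a fin_num.
Proof.
case=> mu1 _ _ _ A mA; rewrite ge0_fin_numE//.
apply: le_lt_trans (ltry 1); rewrite -mu1.
by apply: le_measure => //; rewrite inE//; exact: measurableT.
Qed.

(* If [muH (C `&` H)] were smaller than [muG C], then a union of [k] cosets of [C]
   could never cover [H], so [C] would have infinitely many disjoint cosets of
   equal positive measure. *)
Lemma haar_closed_subgroup_le : muG C <= muH (C `&` H).
Proof.
have [clC C1 CM CV] := sC; have [clH H1 HM HV] := sH.
have [muG1 _ _ invG] := hG; have [muH1 muHH _ invH] := hH.
have mC : measurable (C : set (borel G)) by exact: closed_borel.
have mH : measurable (H : set (borel G)) by exact: closed_borel.
have mCH : measurable (C `&` H : set (borel G)) by exact: measurableI.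
rewrite leNgt; apply/negP => lt_ba.
have [a0 fa] : 0 <= muG C /\ muG C = (fine (muG C))%:E.
  by rewrite fineK//; exact: haar_fin hG _ mC.
have [b0 fb] : 0 <= muH (C `&` H) /\ muH (C `&` H) = (fine (muH (C `&` H)))%:E.
  by rewrite fineK//; exact: haar_fin hH _ mCH.
move: lt_ba a0 b0; set a := fine _ in fa; set b := fine _ in fb.
rewrite fa fb !lte_fin !lee_fin => lt_ba a0 b0.
(* [S] is a union of [k] disjoint left cosets of [C] with representatives in [H]; its stability
   under right multiplication by [C] is all that the induction needs of this structure. *)
have cosets k : exists S : set G, [/\ measurable (S : set (borel G)),
    forall x c, S x -> C c -> S (mul x c), muG S = (a *+ k)%:E &
    muH (S `&` H) <= (b *+ k)%:E].
  elim: k => [|k [S [mS SC muGS muHS]]].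
    by exists set0; split => //; rewrite ?set0I measure0.
  have ak1 : (a *+ k <= 1)%R.
    rewrite -lee_fin -muGS -muG1.
    by apply: le_measure => //; rewrite inE//; exact: measurableT.
  (* If [S] contained [H], then 1 <= b k; but b k < a k <= 1 for k > 0, and b k = 0 for k = 0, where
     the strict comparison of multiples fails. *)
  have [h Hh nSh] : exists2 h, H h & ~ S h.
    apply: contrapT => noh; have HS : S `&` H = H.
      by apply: setIidr => h Hh; apply: contrapT => nSh; apply: noh; exists h.
    move: muHS; rewrite HS muHH lee_fin; apply/negP; rewrite -ltNge.
    case: k ak1 {muGS} => [|k] ak1; first by rewrite mulr0n ltr01.
    by apply: lt_le_trans ak1; rewrite ltrMn2r.
  pose hC := [set mul h c | c in C].
  have mhC : measurable (hC : set (borel G)) by apply: closed_borel; exact: closed_coset.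
  exists (S `|` hC); split.
  - exact: measurableU.
  - move=> x c [Sx|[d Cd <-]] Cc; first by left; exact: SC.
    by right; exists (mul d c); [exact: CM|rewrite gmulA].
  - transitivity (muG S + muG hC).
      apply: measureU => //; rewrite -subset0 => x [Sx [c Cc xE]]; apply: nSh.
      by rewrite -(gmulgK c h) xE; apply: SC => //; exact: CV.
    by rewrite muGS invG// fa -EFinD mulrSr.
  (* Since [h] is in [H], the coset hC meets [H] exactly in the translate by [h] of the intersection
     of [C] and [H], whose [muH]-measure is b by invariance. *)
  - have -> : (S `|` hC) `&` H = (S `&` H) `|` [set mul h c | c in C `&` H].
      rewrite setIUl; congr (_ `|` _); apply/seteqP; split => x.
        move=> [[c Cc <-] Hx]; exists c => //; split => //.
        by rewrite -(gmulKg h c); apply: HM => //; exact: HV.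
      by move=> [c [Cc Hc] <-]; split; [exists c|exact: HM].
    apply: le_trans (measureU2 _ _ _) _.
    - exact: measurableI.
    - by apply: closed_borel; apply: closed_coset; exact: closedI.
    rewrite mulrSr EFinD -fb -(invH _ _ Hh mCH); exact: leeD2r.
have a_gt0 : (0 < a)%R by exact: le_lt_trans lt_ba.
(* This number of cosets exceeds 1 / a, so their union would have measure greater than 1. *)
have [S [mS _ muGS _]] := cosets (Num.bound a^-1).
have : (a *+ Num.bound a^-1 <= 1)%R.
  rewrite -lee_fin -muGS -muG1.
  by apply: le_measure => //; rewrite inE//; exact: measurableT.
apply/negP; rewrite -ltNge -mulr_natl -ltr_pdivrMr// div1r.
by apply: archi_boundP; rewrite invr_ge0 ltW.
Qed.

End HaarMeasure.
End CompactGroupTheory.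

(** * Product measures on cylinders over the first coordinates *)

Section ProductMeasures.
Context {G : ptopologicalType} {n : nat}.

Definition measurable_boxes : set (set (pw n.+1 G)) :=
  [set init_box N | N in [set N | forall i, measurable (N i : set (borel G))]].

(** The product sigma-algebra of G^n, pulled back to G^(n+1). Equality of finite measures on it can
    be checked on [measurable_boxes]. *)
Definition init_sigma : set (set (pw n.+1 G)) := <<s measurable_boxes >>.

Definition last_in (O : set G) : set (pw n.+1 G) := [set x | O (last_coord x)].

Lemma last_in_borel (O : set G) : measurable (O : set (borel G)) ->
  measurable (last_in O : set (borel (pw n.+1 G))).
Proof. by move=> mO; apply: continuous_borel => //; exact: pw_coord_continuous. Qed.

Lemma init_box_borel (N : 'I_n.+1 -> set G) :
  (forall i, measurable (N i : set (borel G))) ->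
  measurable (init_box N : set (borel (pw n.+1 G))).
Proof.
move=> mN.
rewrite (_ : init_box N = \bigcap_(i in [set i : 'I_n.+1 | (i < n)%N])
                            ((fun x : pw n.+1 G => x i) @^-1` N i)) //.
apply: (@fin_bigcap_measurable _ (borel (pw n.+1 G))) => // i _.
by apply: continuous_borel => //; exact: pw_coord_continuous.
Qed.

Lemma init_sigma_borel (D : set (pw n.+1 G)) :
  init_sigma D -> measurable (D : set (borel (pw n.+1 G))).
Proof.
move: D; apply: smallest_sub; first exact: sigma_algebra_measurable.
by move=> _ [N mN <-]; exact: init_box_borel.
Qed.

Lemma measurable_boxesI : setI_closed measurable_boxes.
Proof.
move=> _ _ [N mN <-] [M mM <-]; exists (fun i => N i `&` M i).
  by move=> i; apply: (@measurableI _ (borel G)); [exact: mN|exact: mM].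
apply/seteqP; split=> [x NMx|x [Nx Mx] i ni]; last by split; [exact: Nx|exact: Mx].
by split=> i /NMx[].
Qed.

Lemma init_box_lastE (N : 'I_n.+1 -> set G) (O : set G) :
  init_box N `&` last_in O =
  [set x : pw n.+1 G | forall i : 'I_n.+1, (if (i < n)%N then N i else O) (x i)].
Proof.
apply/seteqP; split=> [x [Nx Ox] i|x NOx].
  by case: ifPn => [/Nx//|/ord_maxPn->].
split=> [i ni|]; first by have := NOx i; rewrite ni.
by have := NOx ord_max; rewrite /= ltnn.
Qed.

Lemma init_boxE (N : 'I_n.+1 -> set G) :
  init_box N = [set x : pw n.+1 G | forall i : 'I_n.+1, (if (i < n)%N then N i else setT) (x i)].
Proof. by rewrite -init_box_lastE setIT. Qed.

Lemma compact_init_box (N : 'I_n.+1 -> set G) :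
  compact [set: G] -> (forall i, compact (N i)) -> compact (init_box N).
Proof.
move=> cG cN; rewrite init_boxE.
apply: (@tychonoff 'I_n.+1 (fun=> G) (fun i : 'I_n.+1 => if (i < n)%N then N i else setT)) => i.
by case: ifP.
Qed.

Context {R : realType}.
Local Open Scope ereal_scope.

Lemma product_measure_box (mus : 'I_n.+1 -> {measure set (borel G) -> \bar R})
    (nu : {measure set (borel (pw n.+1 G)) -> \bar R}) (N : 'I_n.+1 -> set G) (O : set G) :
  is_product_measure mus nu -> (forall i, measurable (N i : set (borel G))) ->
  measurable (O : set (borel G)) ->
  nu (init_box N `&` last_in O) =
    (\prod_(i < n) mus (widen_ord (leqnSn n) i) (N (widen_ord (leqnSn n) i)))
    * mus ord_max O.
Proof.
move=> [_ nuE] mN mO; rewrite init_box_lastE.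
etransitivity.
  by apply: (nuE (fun i : 'I_n.+1 => if (i < n)%N then N i else O)) => i; case: ifP.
rewrite big_ord_recr /= ltnn; congr (_ * _); apply: eq_bigr => i _.
by rewrite /= ltn_ord.
Qed.

(** As functions of [D], both sides are finite measures that agree on [measurable_boxes] by the
    product formula. These boxes are closed under intersection and include the whole space, so the
    two measures agree on [init_sigma]. *)
Lemma product_measure_factor (mus1 mus2 : 'I_n.+1 -> {measure set (borel G) -> \bar R})
    (nu1 nu2 : {measure set (borel (pw n.+1 G)) -> \bar R}) (O : set G) (D : set (pw n.+1 G)) :
  is_product_measure mus1 nu1 -> is_product_measure mus2 nu2 ->
  (forall i : 'I_n.+1, (i < n)%N -> mus1 i = mus2 i) ->
  mus1 ord_max [set: G] = 1 -> mus2 ord_max [set: G] = 1 -> nu1 setT < +oo ->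
  measurable (O : set (borel G)) -> init_sigma D ->
  nu1 (D `&` last_in O) = mus1 ord_max O * nu2 D.
Proof.
move=> P1 P2 e12 m1 m2 fin1 mO sD.
have fO : mus1 ord_max O \is a fin_num.
  rewrite ge0_fin_numE//; apply: le_lt_trans (ltry 1); rewrite -m1.
  by apply: le_measure => //; rewrite inE//; exact: measurableT.
have f0 : (0 <= fine (mus1 ord_max O))%R by rewrite fine_ge0.
have mlO := last_in_borel mO.
rewrite -(fineK fO).
have := @g_sigma_algebra_measure_unique _ R (borel (pw n.+1 G)) measurable_boxes _
  (fun=> setT) _ _ (mrestr nu1 mlO) (mscale (NngNum f0) nu2) measurable_boxesI _ _ D sD.
apply.
- by move=> _ [N mN <-]; exact: init_box_borel.
- move=> _; exists (fun=> setT); first by move=> i; exact: (@measurableT _ (borel G)).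
  by apply/seteqP; split.
- by rewrite bigcup_const//; exists 0%N.
- move=> _ [N mN <-].
  transitivity (nu1 (init_box N `&` last_in O)) => //.
  transitivity (mus1 ord_max O * nu2 (init_box N `&` last_in setT)); last first.
    by rewrite /= /mscale /= fineK// setIT.
  rewrite (product_measure_box P1)// (product_measure_box P2)//.
  rewrite m2 mule1 muleC; congr (_ * _); apply: eq_bigr => i _.
  by rewrite e12 //= ltn_ord.
- move=> _; apply: le_lt_trans fin1.
  by rewrite /= /mrestr; apply: le_measure => //; rewrite inE//; exact: measurableI.
Qed.

End ProductMeasures.

(** * Iterated commutators as functions on powers of G *)

Lemma eq_iter_comm (G : ptopologicalType) (mul : G -> G -> G) (inv : G -> G)
    (f g : nat -> G) k :
  (forall i, (i <= k)%N -> f i = g i) -> iter_comm mul inv f k = iter_comm mul inv g k.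
Proof.
elim: k => [fg|k IH fg] /=; first exact: fg.
by rewrite IH ?fg// => i ik; exact/fg/leqW.
Qed.

Section IteratedCommutators.
Context {G : ptopologicalType} {mul : G -> G -> G} {inv : G -> G} {one : G}.
Hypothesis cG : is_compact_group mul inv one.

Lemma continuous_iter_comm m k :
  continuous (fun x : pw m.+1 G => iter_comm mul inv (fun i => x (inord i)) k).
Proof.
elim: k => [|k IH] /=; first exact: pw_coord_continuous.
by apply: (continuous_comm cG) => //; exact: pw_coord_continuous.
Qed.

Lemma closed_comm_trivial_set n : closed (comm_trivial_set mul inv one n).
Proof.
apply: (@preimage_closed _ _ (fun x : pw n.+1 G => iter_comm mul inv (fun i => x (inord i)) n)
  [set one]); last exact: closed_set1_group cG.
by apply: in1W; exact: continuous_iter_comm.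
Qed.

(** The section over the first coordinates is the centralizer of their iterated commutator, hence a
    closed subgroup. *)
Lemma comm_trivial_set_last n (x : pw n.+2 G) (g : G) :
  comm_trivial_set mul inv one n.+1 (set_last x g) <->
  comm mul inv (iter_comm mul inv (fun i => x (inord i)) n) g = one.
Proof.
rewrite /comm_trivial_set /=.
suff [-> ->] : iter_comm mul inv (fun i => set_last x g (inord i)) n =
    iter_comm mul inv (fun i => x (inord i)) n /\ set_last x g (inord n.+1) = g by [].
split; last by rewrite /set_last inordK ?ltnn.
by apply: eq_iter_comm => i ik; rewrite /set_last inordK ?ltnS ?ik// ltnW.
Qed.

End IteratedCommutators.

(** * Comparison of the two nilpotency degrees *)

Section RelativeNilpotency.
Context {R : realType} {G : ptopologicalType} {mul : G -> G -> G} {inv : G -> G} {one : G}.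
Context {H : set G} {n : nat}.
Context {muG muH : {measure set (borel G) -> \bar R}}.
Context {nuHG nuH : {measure set (borel (pw n.+2 G)) -> \bar R}}.
Hypothesis cG : is_compact_group mul inv one.
Hypothesis sH : closed_subgroup mul inv one H.
Hypothesis hG : haar_measure mul [set: G] muG.
Hypothesis hH : haar_measure mul H muH.
Hypothesis pHG :
  is_product_measure (fun i : 'I_n.+2 => if (i < n.+1)%N then muH else muG) nuHG.
Hypothesis pH : is_product_measure (fun _ : 'I_n.+2 => muH) nuH.
Local Open Scope ereal_scope.

Let E : set (pw n.+2 G) := comm_trivial_set mul inv one n.+1 `&` init_box (fun=> H).

Let closedE : closed E.
Proof.
have [cH _ _ _] := sH.
by apply: closedI; [exact: closed_comm_trivial_set cG _|exact: closed_init_box].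
Qed.

Lemma product_haar_setT : nuHG setT = 1 /\ nuH setT = 1.
Proof.
have [muG1 _ _ _] := hG; have [muH1 _ _ _] := hH.
have total mus (nu : {measure set (borel (pw n.+2 G)) -> \bar R}) :
    is_product_measure mus nu -> (forall i, mus i setT = 1) -> nu setT = 1.
  move=> [_ nuE] mus1; rewrite (_ : setT = [set x : pw n.+2 G | forall i, setT (x i)]).
    etransitivity; first by apply: (nuE (fun=> setT)) => i; exact: (@measurableT _ (borel G)).
    by apply: big1 => i _; exact: mus1.
  by apply/seteqP; split.
by split; [apply: total pHG _ => i; case: ifP|apply: total pH _].
Qed.

(** Both formulas carry the same factor [nuHG D], because the two products share all factors but the
    last; comparing them reduces to comparing [muG] and [muH]. *)
Lemma product_haar_factor (O : set G) (D : set (pw n.+2 G)) :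
  measurable (O : set (borel G)) -> init_sigma D ->
  nuHG (D `&` last_in O) = muG O * nuHG D /\ nuH (D `&` last_in O) = muH O * nuHG D.
Proof.
move=> mO sD; have [muG1 _ _ _] := hG; have [muH1 _ _ _] := hH.
have [t1 t2] := product_haar_setT.
split.
  rewrite (product_measure_factor pHG pHG _ _ _ _ mO sD) /= ?ltnn//.
  by rewrite t1 ltry.
rewrite (product_measure_factor pH pHG _ _ _ _ mO sD) /= ?ltnn//.
  by move=> i ->.
by rewrite t2 ltry.
Qed.

(** The inequality is claimed for every [D] inside the box, since the overlapping boxes of a finite
    cover will be cut into disjoint pieces. *)
Lemma local_nilpotency_le (U : set (pw n.+2 G)) (e : R) (x : pw n.+2 G) :
  open U -> E `&` last_in H `<=` U -> (0 < e)%R -> init_box (fun=> H) x ->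
  exists N : 'I_n.+2 -> set G, (forall i, open_nbhs (x i) (N i)) /\
    forall D, init_sigma D -> D `<=` init_box N ->
      nuHG (E `&` D) <= nuH (U `&` D) + e%:E * nuHG D.
Proof.
move=> oU EU e0 Hx; have [cH _ _ _] := sH; have [_ [_ _ _ kG]] := cG.
pose C := [set g | comm mul inv (iter_comm mul inv (fun i => x (inord i)) n) g = one].
have sC : closed_subgroup mul inv one C by exact: closed_centralizer cG _.
have [cC _ _ _] := sC.
have mC : measurable (C : set (borel G)) by exact: closed_borel.
have mCH : measurable (C `&` H : set (borel G)) by apply: closed_borel; exact: closedI.
have EC g : C g <-> E (set_last x g).
  split=> [Cg|[/comm_trivial_set_last]//].
  split; first exact/comm_trivial_set_last.
  by move=> i ni; rewrite /set_last ni; exact: Hx.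
(* Outer regularity of [muG] at [C]; finiteness of [muG C] makes the inequality strict. *)
have [V [oV CV] muV] : exists2 O, open O /\ C `<=` O & muG O < muG C + e%:E.
  have [_ _ /(_ C mC)[muC _] _] := hG.
  have : muG C < muG C + e%:E by rewrite lteDl ?lte_fin//; exact: haar_fin hG _ mC.
  by rewrite {1}muC => /ereal_inf_lt[_ [V VC <-] ?]; exists V.
have mV : measurable (V : set (borel G)) by exact: open_borel.
(* The tube lemma for the compact complement of [V] and the open complement of [E]: over [N1],
   points of [E] have their last coordinate in [V]. *)
have [N1 [oN1 N1E]] : exists N : 'I_n.+2 -> set G, (forall i, open_nbhs (x i) (N i)) /\
    forall y, init_box N y -> (~` V) (last_coord y) -> (~` E) y.
  apply: tube_lemma; last by move=> g nVg /EC /CV.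
    by apply: subclosed_compact kG _ => //; exact: open_closedC.
  exact: closed_openC.
have [N2 [oN2 N2U]] : exists N : 'I_n.+2 -> set G, (forall i, open_nbhs (x i) (N i)) /\
    forall y, init_box N y -> (C `&` H) (last_coord y) -> U y.
  apply: tube_lemma => //.
    by apply: subclosed_compact kG _ => //; exact: closedI.
  move=> g [/EC Eg Hg]; apply: EU; split => //.
  by rewrite /last_in /last_coord /= /set_last /= ltnn.
exists (fun i => N1 i `&` N2 i); split=> [i|D sD DN]; first exact: open_nbhsI.
have mD := init_sigma_borel sD.
have [facG _] := product_haar_factor mV sD.
have [_ facH] := product_haar_factor mCH sD.
have mE : measurable (E : set (borel (pw n.+2 G))) by exact: closed_borel.
have mU : measurable (U : set (borel (pw n.+2 G))) by exact: open_borel.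
apply: (@le_trans _ _ (nuHG (D `&` last_in V))).
  apply: le_measure.
  - by rewrite inE; exact: measurableI.
  - by rewrite inE; apply: measurableI => //; exact: last_in_borel.
  move=> y [Ey Dy]; split => //; apply: contrapT => nVy.
  by apply: (N1E y _ nVy Ey) => i /(DN y Dy) [].
rewrite facG; apply: (@le_trans _ _ ((muH (C `&` H) + e%:E) * nuHG D)).
  apply: lee_wpmul2r => //; apply: (le_trans (ltW muV)); apply: leeD2r.
  exact: (haar_closed_subgroup_le cG sH sC hG hH).
rewrite ge0_muleDl ?lee_fin ?(ltW e0)//; apply: leeD2r.
rewrite -facH; apply: le_measure.
- by rewrite inE; apply: measurableI => //; exact: last_in_borel.
- by rewrite inE; exact: measurableI.
move=> y [Dy CHy]; split => //.
by apply: N2U => // i /(DN y Dy) [].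
Qed.

Lemma nilpotency_le_open (U : set (pw n.+2 G)) (e : R) :
  open U -> E `&` last_in H `<=` U -> (0 < e)%R -> nuHG E <= nuH U + e%:E.
Proof.
move=> oU EU e0; have [cH _ _ _] := sH; have [_ [_ _ _ kG]] := cG.
have mE : measurable (E : set (borel (pw n.+2 G))) by exact: closed_borel.
have mU : measurable (U : set (borel (pw n.+2 G))) by exact: open_borel.
(* Quantifying over all [D] inside [B] makes the property stable under unions: [D] splits into its
   parts inside and outside the first set, and the inequalities add up. *)
pose good (B : set (pw n.+2 G)) := init_sigma B /\ forall D, init_sigma D -> D `<=` B ->
  nuHG (E `&` D) <= nuH (U `&` D) + e%:E * nuHG D.
have good0 : good set0.
  split; first exact: (@measurable0 _ (g_sigma_algebraType measurable_boxes)).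
  by move=> D _; rewrite subset0 => ->; rewrite !setI0 !measure0 mule0 adde0.
have goodU A B : good A -> good B -> good (A `|` B).
  move=> [sA gA] [sB gB]; split.
    exact: (@measurableU _ (g_sigma_algebraType measurable_boxes)).
  move=> D sD DAB.
  have sDA : init_sigma (D `&` A).
    exact: (@measurableI _ (g_sigma_algebraType measurable_boxes)).
  have sDB : init_sigma (D `\` A).
    exact: (@measurableD _ (g_sigma_algebraType measurable_boxes)).
  have split_meas (nu : {measure set (borel (pw n.+2 G)) -> \bar R}) (X : set (pw n.+2 G)) :
      measurable (X : set (borel (pw n.+2 G))) ->
      nu (X `&` D) = nu (X `&` (D `&` A)) + nu (X `&` (D `\` A)).
    move=> mX; transitivity (nu ((X `&` (D `&` A)) `|` (X `&` (D `\` A)))).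
      by congr (nu _); rewrite -setIUr setUIDK.
    apply: measureU.
    - by apply: measurableI => //; exact: init_sigma_borel.
    - by apply: measurableI => //; exact: init_sigma_borel.
    - by rewrite -subset0 => y [[_ [_ ?]] [_ []]].
  have nuD : nuHG D = nuHG (D `&` A) + nuHG (D `\` A).
    by have := split_meas nuHG setT (@measurableT _ (borel _)); rewrite !setTI.
  rewrite !split_meas// nuD ge0_muleDr// addeACA; apply: leeD.
    by apply: gA => // y [].
  by apply: gB => // y [/DAB[]].
have /choice[N Nx] : forall x, exists N : 'I_n.+2 -> set G, init_box (fun=> H) x ->
    (forall i, open_nbhs (x i) (N i)) /\ good (init_box N).
  move=> x; case: (pselect (init_box (fun=> H) x)) => [Hx|nHx]; last by exists (fun=> setT).
  have [N [oN NE]] := local_nilpotency_le oU EU e0 Hx; exists N => _; split => //; split => //.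
  apply: sub_sigma_algebra; exists N => // i.
  by apply: open_borel; case: (oN i).
(* This cylinder is H^(n+1) times G, so its compactness uses that of G in the last factor. *)
have kbox : compact (init_box (fun _ : 'I_n.+2 => H)).
  by apply: compact_init_box => // _; exact: subclosed_compact kG _.
move: kbox; rewrite compact_cover => /(_ _ (init_box (fun=> H)) (fun x => init_box (N x))).
case=> [x Hx|x Hx|X XH].
- by apply: open_init_box => i; case: (Nx x Hx) => /(_ i)[].
- by exists x => // i _; case: (Nx x Hx) => /(_ i)[].
rewrite /cover bigcup_fset => Hcov.
set B := \big[setU/set0]_(i <- _) _ in Hcov.
have [sB gB] : good B.
  rewrite /B big_seq; apply: big_ind => // x /XH; rewrite inE => Hx.
  by case: (Nx x Hx).
have EB : E `&` B = E by apply: setIidl; apply: subset_trans Hcov; exact: subIsetr.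
have := gB B sB (@subset_refl _ B); rewrite EB => /le_trans; apply.
have mB := init_sigma_borel sB.
apply: leeD.
  by apply: le_measure; [rewrite inE; exact: measurableI|rewrite inE|exact: subIsetl].
(* The error terms of all pieces have been collected into e times [nuHG B], and [nuHG] has total
   mass 1. *)
rewrite -[leRHS]mule1; apply: lee_wpmul2l; first by rewrite lee_fin ltW.
have [<- _] := product_haar_setT.
by apply: le_measure; [rewrite inE|rewrite inE; exact: measurableT|].
Qed.

(** Outer regularity of [nuH] turns the right side into an infimum over open [U], to which the
    previous bound applies with arbitrarily small e. *)
Lemma nilpotency_le : nuHG E <= nuH (E `&` last_in H).
Proof.
have [cH _ _ _] := sH.
have mEH : measurable (E `&` last_in H : set (borel (pw n.+2 G))).
  apply: measurableI; first exact: closed_borel.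
  by apply: last_in_borel; exact: closed_borel.
have [/(_ _ mEH)[-> _] _] := pH.
apply: le_ereal_inf_tmp => _ [U [oU EU] <-].
by apply/lee_addgt0Pr => e e0; exact: nilpotency_le_open.
Qed.

End RelativeNilpotency.

Theorem theorem3p1 (R : realType) (G : ptopologicalType)
  (mul : G -> G -> G) (inv : G -> G) (one : G) (H : set G) (n : nat) :
  is_compact_group mul inv one ->
  closed_subgroup mul inv one H ->
  (1 <= n)%N ->
  forall muG muH : {measure set (borel G) -> \bar R},
  haar_measure mul [set: G] muG ->
  haar_measure mul H muH ->
  forall nuHG nuH : {measure set (borel (pw n.+1 G)) -> \bar R},
  (* nuHG = mu_H^n x mu_G on H^n x G *)
  is_product_measure (fun i : 'I_n.+1 => if (i < n)%N then muH else muG) nuHG ->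
  (* nuH = mu_H^(n+1) on H^(n+1) *)
  is_product_measure (fun _ : 'I_n.+1 => muH) nuH ->
  (nuHG (comm_trivial_set mul inv one n
           `&` [set x : pw n.+1 G | forall i : 'I_n.+1, (i < n)%N -> H (x i)])
   <= nuH (comm_trivial_set mul inv one n
           `&` [set x : pw n.+1 G | forall i : 'I_n.+1, H (x i)]))%E.
Proof.
(* With n a successor, the last step of [iter_comm] is a genuine commutator, so the sections in the
   last coordinate are centralizers. *)
case: n => // n cG sH _ muG muH hG hH nuHG nuH pHG pH.
rewrite (_ : [set x : pw n.+2 G | forall i : 'I_n.+2, H (x i)] =
  init_box (fun=> H) `&` last_in H).
  by rewrite setIA; exact: nilpotency_le cG sH hG hH pHG pH.
rewrite init_box_lastE; apply: eq_set => x; apply: eq_forall => i.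
by rewrite if_same.
Qed.
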